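(* Let $\Pi$ be an abstract pattern space over $(X,\Gamma)$ which admits a unique zero element $0$. Let $\Sigma$ be a nonempty subset of $\Pi$ which is atomistic and has the limit inclusion property. Then the local matching topology on $\Sigma$ is Hausdorff.
   Context: Setting. $X$ is a nonempty proper metric space (closed balls are compact). $\Gamma$ is a group with a left-invariant proper metric $\rho_\Gamma$, and $\Gamma$ is a topological group for the metric topology. $\Gamma$ acts on $X$ by isometries and the action map $\Gamma\times X\to X$ is (jointly) continuous. $\mathrm{Cl}(X)$ is the set of closed subsets of $X$, $\mathrm{Cpt}(X)$ the set of compact subsets of $X$, and $\mathscr{V}$ the set of compact neighborhoods of the identity $e\in\Gamma$. Abstract pattern spaces. An abstract pattern space over $X$ is a nonempty set $\Pi$ with a map (cutting-off operation) $\Pi\times \mathrm{Cl}(X)\to\Pi$, $(\mathcal{P},C)\mapsto\mathcal{P}\wedge C$, such that (1) $(\mathcal{P}\wedge C_1)\wedge C_2=\mathcal{P}\wedge(C_1\cap C_2)$ for all $\mathcal{P}\in\Pi$ and $C_1,C_2\in\mathrm{Cl}(X)$; (2) for every $\mathcal{P}\in\Pi$ there is a (necessarily unique) closed set, denoted $\operatorname{supp}\mathcal{P}$, such that for all $C\in\mathrm{Cl}(X)$: $\mathcal{P}\wedge C=\mathcal{P}\iff C\supset\operatorname{supp}\mathcal{P}$. It is an abstract pattern space over $(X,\Gamma)$ if moreover $\Gamma$ acts on $\Pi$ and $(\gamma\mathcal{P})\wedge(\gamma C)=\gamma(\mathcal{P}\wedge C)$ for all $\mathcal{P}\in\Pi$,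 $C\in\mathrm{Cl}(X)$, $\gamma\in\Gamma$. Elements of $\Pi$ are called abstract patterns. Order. $\mathcal{P}\geq\mathcal{Q}$ means $\mathcal{P}\wedge\operatorname{supp}\mathcal{Q}=\mathcal{Q}$; this is a partial order on $\Pi$. $\bigvee\Xi$ denotes the supremum of $\Xi\subset\Pi$ for this order, when it exists. A zero element is an element with empty support; if it is unique it is denoted $0$. Atoms. An abstract pattern $\mathcal{P}\in\Pi$ is an atom if $\operatorname{supp}\mathcal{P}$ is compact and, for $\mathcal{Q}\in\Pi$, $\mathcal{Q}\leq\mathcal{P}$ implies $\mathcal{Q}=\mathcal{P}$ or $\mathcal{Q}=0$. Put $A(\mathcal{P})=\{\mathcal{Q}\text{ atom}\mid\mathcal{Q}\leq\mathcal{P}\}$. A subset $\Sigma\subset\Pi$ is atomistic if for every $\mathcal{P}\in\Sigma$ the supremum $\bigvee A(\mathcal{P})$ exists and equals $\mathcal{P}$. A subset $\Sigma\subset\Pi$ has the limit inclusion property if for every $\mathcal{P}\in\Sigma$ and every atom $\mathcal{Q}\in\Pi$: if for each $V\in\mathscr{V}$ there is $\gamma_V\in V$ with $\gamma_V\mathcal{Q}\leq\mathcal{P}$, then $\mathcal{Q}\leq\mathcal{P}$. Local matching topology. For $K\in\mathrm{Cpt}(X)$ and $V\in\mathscr{V}$ let $\mathcal{U}_{K,V}=\{(\mathcal{P},\mathcal{Q})\in\Pi\times\Pi\mid\exists\gamma\in V:\ \mathcal{P}\wedge K=(\gamma\mathcal{Q})\wedge K\}$. These sets form a fundamental system of entourages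 of a uniform structure on $\Pi$, the local matching uniform structure; the induced topology is the local matching topology. On a subset $\Sigma\subset\Pi$ one uses the induced (relative) uniform structure and topology. *)

(* Defs.v *)
From HB Require Import structures.
From mathcomp Require Import all_boot all_order all_algebra.
From mathcomp Require Import all_classical all_reals topology.

Set Implicit Arguments.
Unset Strict Implicit.
Unset Printing Implicit Defensive.

Import Order.TTheory GRing.Theory Num.Theory.

Local Open Scope classical_set_scope.
Local Open Scope ring_scope.

HB.mixin Record Metric_isProper (R : realType) X & Metric R X := {
  closed_ball_compact : forall (x : X) (r : R),
    compact [set y | mdist x y <= r]
}.

#[short(type="properMetricType")]
HB.structure Definition ProperMetric (R : realType) :=
  { X of Metric R X & Metric_isProper R X }.

HB.structure Definition MetricGroup (R : realType) :=
  { G of ProperMetric R G & Group G }.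

HB.mixin Record MetricGroup_isLeftInvariantTopological (R : realType) G
    & MetricGroup R G := {
  mdist_mulgl : forall g x y : G, mdist (g * x)%g (g * y)%g = mdist x y ;
  mulg_continuous : continuous (fun p : G * G => (p.1 * p.2)%g) ;
  invg_continuous : continuous (fun g : G => g^-1%g)
}.

#[short(type="properMetricGroupType")]
HB.structure Definition ProperMetricGroup (R : realType) :=
  { G of MetricGroup R G & MetricGroup_isLeftInvariantTopological R G }.

Record group_action (G : groupType) (T : Type) := GroupAction {
  act :> G -> T -> T ;
  act1 : forall x, act 1%g x = x ;
  actM : forall g h x, act (g * h)%g x = act g (act h x)
}.

Record isometric_action (R : realType) (G : properMetricGroupType R)
    (X : properMetricType R) := IsometricAction {
  iact :> group_action G X ;
  iact_isometry : forall g x y, mdist (iact g x) (iact g y) = mdist x y ;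
  iact_continuous : continuous (fun p : G * X => iact p.1 p.2)
}.

(* [cutoff] is total on sets; its values off closed sets are unconstrained
   and never used. The support is unique (lemma [supp_unique]), so carrying it
   as a field is the same as asserting its existence. *)
Record pattern_space (X : topologicalType) := PatternSpace {
  pattern :> Type ;
  cutoff : pattern -> set X -> pattern ;
  supp : pattern -> set X ;
  pattern_nonempty : inhabited pattern ;
  cutoff_cutoff : forall p C1 C2, closed C1 -> closed C2 ->
    cutoff (cutoff p C1) C2 = cutoff p (C1 `&` C2) ;
  closed_supp : forall p, closed (supp p) ;
  cutoff_id : forall p C, closed C -> (cutoff p C = p <-> supp p `<=` C)
}.

Arguments closed_supp {X P} p : rename.

Record equivariant_pattern_space (R : realType) (X : properMetricType R)
    (G : properMetricGroupType R) (alpha : isometric_action G X) :=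
  EquivariantPatternSpace {
  epattern :> pattern_space X ;
  pact : group_action G epattern ;
  pact_cutoff : forall (p : epattern) (C : set X) (g : G), closed C ->
    cutoff (pact g p) (alpha g @` C) = pact g (cutoff p C)
}.

Section PatternOrder.
Context {X : topologicalType} {P : pattern_space X}.
Implicit Types (p q : P) (C : set X).

Lemma supp_unique p S : closed S ->
  (forall C, closed C -> (cutoff p C = p <-> S `<=` C)) -> S = supp p.
Proof.
move=> cS hS; apply/seteqP; split.
- by apply: (proj1 (hS _ (closed_supp p))); apply: (proj2 (cutoff_id p (closed_supp p))).
- by apply: (proj1 (cutoff_id p cS)); apply: (proj2 (hS _ cS)).
Qed.

Lemma supp_cutoff_l p C : closed C -> supp (cutoff p C) `<=` C.
Proof. by move=> cC; apply: (proj1 (cutoff_id _ cC)); rewrite cutoff_cutoff// setIid. Qed.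

Lemma cutoff_supp p : cutoff p (supp p) = p.
Proof. exact: (proj2 (cutoff_id p (closed_supp p))). Qed.

Lemma supp_cutoff_r p C : closed C -> supp (cutoff p C) `<=` supp p.
Proof.
move=> cC; have cs := closed_supp p; apply: (proj1 (cutoff_id _ cs)).
by rewrite cutoff_cutoff// setIC -cutoff_cutoff// cutoff_supp.
Qed.

Definition pattern_le p q : bool := `[< cutoff q (supp p) = p >].

Lemma pattern_le_refl : reflexive pattern_le.
Proof. by move=> p; apply/asboolP; exact: cutoff_supp. Qed.

Lemma pattern_le_supp p q : pattern_le p q -> supp p `<=` supp q.
Proof.
by move=> /asboolP <-; apply: supp_cutoff_r; exact: closed_supp.
Qed.

Lemma pattern_le_anti : antisymmetric pattern_le.
Proof.
move=> p q /andP[pq qp].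
have spq : supp p = supp q by apply/seteqP; split; exact: pattern_le_supp.
by move/asboolP : pq; rewrite spq cutoff_supp => <-.
Qed.

Lemma pattern_le_trans : transitive pattern_le.
Proof.
move=> q p r pq qr; have spq := pattern_le_supp pq.
move/asboolP : pq => pq; move/asboolP : qr => qr; apply/asboolP.
rewrite -(setIidr spq) -cutoff_cutoff; [|exact: closed_supp..].
by rewrite qr.
Qed.

End PatternOrder.

Fact pattern_display : Order.disp_t. Proof. exact: Order.default_display. Qed.

HB.instance Definition _ (X : topologicalType) (P : pattern_space X) :=
  gen_eqMixin (pattern P).
HB.instance Definition _ (X : topologicalType) (P : pattern_space X) :=
  gen_choiceMixin (pattern P).
HB.instance Definition _ (X : topologicalType) (P : pattern_space X) :=
  Order.Le_isPOrder.Build pattern_display (pattern P)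
    (@pattern_le_refl X P) (@pattern_le_anti X P) (@pattern_le_trans X P).

Lemma pattern_leP (X : topologicalType) (P : pattern_space X) (p q : P) :
  (p <= q)%O <-> cutoff q (supp p) = p.
Proof. by split=> /asboolP. Qed.

Section Atoms.
Context {X : topologicalType} {P : pattern_space X}.

Definition is_zero (p : P) : Prop := supp p = set0.

(* [zero] is meant to be the unique zero element; read literally, it is then
   itself an atom. *)
Definition atom (zero p : P) : Prop :=
  compact (supp p) /\ forall q : P, (q <= p)%O -> q = p \/ q = zero.

Definition atoms_below (zero p : P) : set P :=
  [set q | atom zero q /\ (q <= p)%O].

Definition atomistic (zero : P) (Sigma : set P) : Prop :=
  forall p, Sigma p -> supremums (atoms_below zero p) p.

End Atoms.

Definition compact_nbhs1 {R : realType} {G : properMetricGroupType R} :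
  set (set G) := [set V | compact V /\ nbhs (1%g : G) V].

Definition limit_inclusion (R : realType) (X : properMetricType R)
    (G : properMetricGroupType R) (alpha : isometric_action G X)
    (P : equivariant_pattern_space alpha) (zero : P) (Sigma : set P) : Prop :=
  forall p q : P, Sigma p -> atom zero q ->
    (forall V, compact_nbhs1 V -> exists2 g, V g & (pact P g q <= p)%O) ->
    (q <= p)%O.

Section LocalMatching.
Context {R : realType} {X : properMetricType R} {G : properMetricGroupType R}.
Context {alpha : isometric_action G X} (P : equivariant_pattern_space alpha).
Implicit Types (K L : set X) (V W : set G).

Definition matching (K : set X) (V : set G) : set (P * P) :=
  [set pq | exists2 g, V g & cutoff pq.1 K = cutoff (pact P g pq.2) K].

Definition local_matching_entourage : set_system (P * P) :=
  [set E | exists K V,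
    [/\ compact K, compact_nbhs1 V & matching K V `<=` E]].

Lemma compact_closedX (K : set X) : compact K -> closed K.
Proof. by apply: compact_closed; exact: metric_hausdorff. Qed.

Lemma compact_closedG (V : set G) : compact V -> closed V.
Proof. by apply: compact_closed; exact: metric_hausdorff. Qed.

Lemma iactK g : cancel (alpha g) (alpha g^-1%g).
Proof. by move=> x; rewrite -actM mulVg act1. Qed.

Lemma iactVK g : cancel (alpha g^-1%g) (alpha g).
Proof. by move=> x; rewrite -actM mulgV act1. Qed.

Lemma pactK g : cancel (pact P g) (pact P g^-1%g).
Proof. by move=> x; rewrite -actM mulVg act1. Qed.

Lemma iact_continuousr g : continuous (alpha g).
Proof.
move=> x; apply: (@continuous_comp _ _ _ (fun x => (g, x))
  (fun p : G * X => alpha p.1 p.2)); last exact: iact_continuous.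
by apply: cvg_pair; [exact: cvg_cst|exact: cvg_id].
Qed.

Lemma closed_iact_image g (C : set X) : closed C -> closed (alpha g @` C).
Proof.
move=> cC; have -> : alpha g @` C = alpha g^-1%g @^-1` C.
  apply/seteqP; split=> [_ [x Cx <-]|x Cx]; first by rewrite /= iactK.
  by exists (alpha g^-1%g x) => //; exact: iactVK.
by move/continuous_closedP : (@iact_continuousr g^-1%g) => /(_ C cC).
Qed.

Lemma cutoff_eq_sub (p q : P) (K L : set X) : closed K -> closed L -> K `<=` L ->
  cutoff p L = cutoff q L -> cutoff p K = cutoff q K.
Proof.
by move=> cK cL KL pq; rewrite -(setIidr KL) -!cutoff_cutoff// pq.
Qed.

Lemma matchingS K L V W : compact K -> compact L -> K `<=` L -> W `<=` V ->
  matching L W `<=` matching K V.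
Proof.
move=> cK cL KL WV [p q] [g Wg] /= pq; exists g; first exact: WV.
by apply: cutoff_eq_sub pq => //; exact: compact_closedX.
Qed.

Lemma compact_iact_image (V : set G) (K : set X) : compact V -> compact K ->
  compact [set alpha p.1 p.2 | p in V `*` K].
Proof.
move=> cV cK; apply: continuous_compact; last exact: compact_setX.
by apply: continuous_subspaceT; exact: iact_continuous.
Qed.

Lemma compact_nbhs1I V W :
  compact_nbhs1 V -> compact_nbhs1 W -> compact_nbhs1 (V `&` W).
Proof.
move=> [cV nV] [cW nW]; split; last exact: filterI.
by apply: compact_closedI => //; exact: compact_closedG.
Qed.

Lemma compact_nbhs1V V : compact_nbhs1 V ->
  compact_nbhs1 [set g^-1%g | g in V].
Proof.
move=> [cV nV]; split.
  by apply: continuous_compact => //; apply: continuous_subspaceT;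
     exact: invg_continuous.
have nV' : nbhs ((1%g : G)^-1%g) V by rewrite invg1.
apply: (@filterS _ (nbhs (1%g : G)) _ ((fun g : G => g^-1%g) @^-1` V));
  last exact: (@invg_continuous R G 1%g V nV').
move=> g /= Vg.
by exists g^-1%g => //; exact: invgK.
Qed.

Lemma compact_nbhs1_ex : exists V : set G, compact_nbhs1 V.
Proof.
exists [set y | mdist (1%g : G) y <= 1]; split; first exact: closed_ball_compact.
have := nbhsx_ballx (1%g : G) (1 : R) ltr01.
by apply: filterS => y; rewrite ballEmdist /=; exact: ltW.
Qed.

Lemma compact_nbhs1_split V : nbhs (1%g : G) V ->
  exists2 W, compact_nbhs1 W & forall g h, W g -> W h -> V (g * h)%g.
Proof.
move=> nV; have nV' : nbhs ((1 : G) * 1)%g V by rewrite mulg1.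
have [[A B] /= [nA nB] AB] := @mulg_continuous R G (1%g, 1%g) V nV'.
have [W0 [cW0 nW0]] := compact_nbhs1_ex.
have : nbhs (1%g : G) (A `&` B `&` W0) by apply: filterI => //; exact: filterI.
rewrite nbhs_ballP => -[e /= e0 eAB].
pose W : set G := [set y | mdist (1%g : G) y <= e / 2].
have WAB : W `<=` A `&` B `&` W0.
  move=> y Wy; apply: eAB; rewrite ballEmdist /=; apply: le_lt_trans Wy _.
  by rewrite ltr_pdivrMr// ltr_pMr// ltr1n.
exists W.
  split; first exact: closed_ball_compact.
  have e20 : 0 < e / 2 by rewrite divr_gt0.
  have := nbhsx_ballx (1%g : G) (e / 2) e20.
  by apply: filterS => y; rewrite ballEmdist /=; exact: ltW.
by move=> g h /WAB[[Ag _] _] /WAB[[_ Bh] _]; exact: (AB (g, h)).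
Qed.

Lemma local_matching_filter : Filter local_matching_entourage.
Proof.
split.
- have [V cV] := compact_nbhs1_ex.
  by exists set0, V; split=> //; exact: compact0.
- move=> E F [K [V [cK cV KE]]] [L [W [cL cW LF]]].
  exists (K `|` L), (V `&` W); split; first exact: compactU.
    exact: compact_nbhs1I.
  move=> x KVx; split; [apply: KE|apply: LF]; apply: matchingS KVx => //.
  + exact: compactU.
  + exact: compactU.
- move=> E F EF [K [V [cK cV KE]]]; exists K, V; split=> //.
  exact: subset_trans EF.
Qed.

Lemma local_matching_diagonal (E : set (P * P)) :
  local_matching_entourage E -> diagonal `<=` E.
Proof.
move=> [K [V [cK [cV nV] KE]]] [p q]; rewrite /diagonal/= => ->; apply: KE.
by exists 1%g; [exact: nbhs_singleton|rewrite /= act1].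
Qed.

Lemma local_matching_inv (E : set (P * P)) :
  local_matching_entourage E -> local_matching_entourage (E^-1)%relation.
Proof.
move=> [K [V [cK cV KE]]].
pose W := [set g^-1%g | g in V].
have cW : compact_nbhs1 W by exact: compact_nbhs1V.
have cVinv : forall g, W g -> V g^-1%g by move=> _ [g Vg <-]; rewrite invgK.
pose L := [set alpha p.1 p.2 | p in W `*` K].
have cL : compact L by apply: compact_iact_image => //; case: cW.
exists L, W; split=> // -[p q] [g Wg] /= pq; apply: KE.
exists g^-1%g; first exact: cVinv.
have cK' := compact_closedX cK; have cgK : closed (alpha g @` K) by exact: closed_iact_image.
have {}pq : cutoff p (alpha g @` K) = cutoff (pact P g q) (alpha g @` K).
  apply: cutoff_eq_sub pq => //; first exact: compact_closedX.
  by move=> _ [x Kx <-]; exists (g, x).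
move: pq => /= /(congr1 (pact P g^-1%g)).
rewrite pact_cutoff// pactK => <-.
rewrite -[in LHS]pact_cutoff//; congr cutoff.
rewrite image_comp -[RHS]image_id; apply: eq_imagel => x _ /=.
exact: iactK.
Qed.

Lemma local_matching_split (E : set (P * P)) :
  local_matching_entourage E ->
  exists2 F, local_matching_entourage F & (F \; F `<=` E)%relation.
Proof.
move=> [K [V [cK [cV nV] KE]]].
have [W cW WV] := compact_nbhs1_split nV.
pose L := [set alpha p.1 p.2 | p in [set g^-1%g | g in W] `*` K].
have cL : compact L.
  by apply: compact_iact_image => //; have [] := compact_nbhs1V cW.
have cKL : compact (K `|` L) by exact: compactU.
exists (matching (K `|` L) W); first by exists (K `|` L), W; split.
move=> [p r] [q [g Wg /= pq] [h Wh /= qr]]; apply: KE.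
exists (g * h)%g; first exact: WV.
have cK' := compact_closedX cK; have cKL' := compact_closedX cKL.
have {}pq : cutoff p K = cutoff (pact P g q) K.
  by apply: cutoff_eq_sub pq => //; exact: subsetUl.
rewrite /= pq actM.
have cgL : closed (alpha g @` (K `|` L)) by exact: closed_iact_image.
apply: (@cutoff_eq_sub _ _ _ (alpha g @` (K `|` L))) => //.
  move=> x Kx; exists (alpha g^-1%g x); last exact: iactVK.
  right.
  by exists (g^-1%g, x) => //; split=> //; exists g.
by rewrite !pact_cutoff// qr.
Qed.

End LocalMatching.

Arguments local_matching_entourage {R X G alpha} P : rename.

(* The topology is the one induced by the uniform structure. *)
HB.instance Definition _ (R : realType) (X : properMetricType R)
    (G : properMetricGroupType R) (alpha : isometric_action G X)
    (P : equivariant_pattern_space alpha) :=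
  isUniform.Build (pattern P) (local_matching_filter P)
    (@local_matching_diagonal R X G alpha P)
    (@local_matching_inv R X G alpha P)
    (@local_matching_split R X G alpha P).

(* Main.v *)
(* If two points of [Sigma] cannot be separated, then for every compact [K] and
   [V] they match on [K] up to some [g] in [V]. Taking for [K] the support of an
   atom below one of them, a translate of the atom by [g^-1] lies below the
   other, so by limit inclusion the atom itself does. Each point thus bounds the
   atoms of the other, of which the latter is the supremum. *)
Require Import Defs.
From HB Require Import structures.
From mathcomp Require Import all_boot all_order all_algebra.
From mathcomp Require Import all_classical all_reals topology.
Local Open Scope classical_set_scope.

Section EquivariantPatterns.
Context (R : realType) (X : properMetricType R) (G : properMetricGroupType R).
Context (alpha : isometric_action G X) (P : equivariant_pattern_space alpha).

(** By equivariance, testing a closed [C] against [pact P g p] amounts to testing its translate by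
    [g^-1] against [p]; uniqueness of the support concludes. *)
Lemma supp_pact (g : G) (p : P) : supp (pact P g p) = alpha g @` supp p.
Proof.
have cs := closed_supp p; apply/esym/supp_unique; first exact: closed_iact_image.
move=> C cC.
have cC' : closed (alpha g^-1%g @` C) by exact: closed_iact_image.
have CE : C = alpha g @` (alpha g^-1%g @` C).
  rewrite image_comp -[LHS]image_id; apply: eq_imagel => x _ /=.
  by rewrite iactVK.
rewrite {1}CE pact_cutoff//; split=> [/(can_inj (@pactK _ _ _ _ P g)) pC|pC].
  rewrite CE; apply: image_subset.
  exact: (proj1 (cutoff_id p cC')).
congr (pact P g _); apply: (proj2 (cutoff_id p cC')) => x px.
exists (alpha g x); last exact: iactK.
by apply: pC; exists x.
Qed.

Lemma pact_le (g : G) (p q : P) :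
  (p <= q)%O -> (pact P g p <= pact P g q)%O.
Proof.
move=> /pattern_leP pq; apply/pattern_leP.
by rewrite supp_pact pact_cutoff ?pq//; exact: closed_supp.
Qed.

Lemma matching_entourage (K : set X) (V : set G) :
  compact K -> compact_nbhs1 V -> entourage (@matching R X G alpha P K V).
Proof. by move=> cK cV; exists K, V; split. Qed.

Lemma atom_le_inseparable (zero : P) (Sigma : set P) (p q a : P) :
  limit_inclusion zero Sigma -> Sigma q ->
  (forall E, entourage E -> E (p, q)) ->
  atom zero a -> (a <= p)%O -> (a <= q)%O.
Proof.
move=> Slim Sq pqE atom_a /pattern_leP ap; apply: Slim => // V cV.
(* Matching translates [q], limit inclusion translates the atom: hence the inverse of [V]. *)
have [] := pqE _ (matching_entourage _ _ (proj1 atom_a) (compact_nbhs1V cV)).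
move=> _ [g Vg <-] /=; rewrite ap => agq; exists g => //.
have /(pact_le g _ _) : (a <= pact P g^-1%g q)%O by apply/pattern_leP.
by rewrite -(actM (pact P)) mulgV act1.
Qed.

End EquivariantPatterns.

Lemma cluster_set_type_entourage (U : uniformType) (A : set U) (x y : A) :
  cluster (nbhs x) y ->
  forall E : set (U * U), entourage E -> E (set_val x, set_val y).
Proof.
move=> xy E entE.
have nE (z : A) (F : set (U * U)) : entourage F ->
    nbhs z (set_val @^-1` xsection F (set_val z)).
  by move=> entF; apply: initial_continuous; exact: nbhs_entourage.
have entF := entourage_split_ent entE.
(* Inverting the half entourage at [y] makes [z] a midpoint of a chain from [x] to [y]. *)
have [z [/= xz yz]] := xy _ _ (nE x _ entF) (nE y _ (entourage_inv entF)).
move: xz yz; rewrite /xsection /= !inE => xz yz.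
exact: (entourage_split (set_val z) entE).
Qed.

(* [Sigma] is coerced to [set_type Sigma], which carries the uniform structure
   and topology induced by the inclusion into [P]. *)
Theorem proposition3p7 (R : realType) (X : properMetricType R)
  (G : properMetricGroupType R) (alpha : isometric_action G X)
  (P : equivariant_pattern_space alpha) (zero : P) (Sigma : set P)
  (X_nonempty : [set: X] !=set0)
  (zero_unique : unique is_zero zero)
  (Sigma_nonempty : Sigma !=set0)
  (Sigma_atomistic : atomistic zero Sigma)
  (Sigma_limit : limit_inclusion zero Sigma) :
  hausdorff_space Sigma.
Proof.
have inseparable_le (p q : P) : Sigma p -> Sigma q ->
    (forall E, entourage E -> E (p, q)) -> (p <= q)%O.
  move=> Sp Sq pqE; have [_] := Sigma_atomistic p Sp; apply.
  by move=> a [atom_a]; exact: atom_le_inseparable Sigma_limit Sq pqE atom_a.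
move=> x y xy.
have xyE := cluster_set_type_entourage _ _ _ _ xy.
have Sx : Sigma (set_val x) by apply: set_mem; exact: valP.
have Sy : Sigma (set_val y) by apply: set_mem; exact: valP.
apply: val_inj; apply/Order.POrderTheory.le_anti/andP.
(* Inverting entourages turns [xyE] into the same statement for the swapped pair. *)
split; apply: inseparable_le => // E /entourage_inv; exact: xyE.
Qed.
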